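(* There are infinitely many pairwise non-isomorphic P-configurations $(I,\delta,\Lambda)$ in $I=[-1,1]$ with $\Lambda_2=\emptyset$ and $\Lambda_1$ consisting of a single point.
   Context: Let $I=[-1,1]$. Two $C^1$ maps $\delta_1,\delta_2:I\to I$ form a P-configuration in $I$ if $\delta_1(t)+\delta_2(t)=t$ for all $t\in I$; $\delta_i'(t)\ge 0$ for all $t\in I$, $i=1,2$; and $\delta_2(-1)=-1$, $\delta_2(1)=\delta_1(-1)=0$, $\delta_1(1)=1$. Its guiding sets are $\Lambda_i=\{t\in I:\delta_i'(t)=0\}$, $i=1,2$, and the P-configuration is denoted $(I,\delta,\Lambda)$, where $\delta=(\delta_1,\delta_2)$ and $\Lambda=(\Lambda_1,\Lambda_2)$. Two P-configurations $(I,\delta,\Lambda)$ and $(I,\sigma,\Omega)$ are isomorphic (conjugate) if there is a homeomorphism $h:I\to I$ such that $h(\Lambda_i)=\Omega_i$ for $i=1,2$ and $h(\delta_i(t))=\sigma_i(h(t))$ for $i=1,2$ and all $t\in I$. *)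

(* Defs.v *)
From Stdlib Require Import Reals.
Open Scope R_scope.

Definition I11 (t : R) : Prop := -1 <= t <= 1.

(* A self-map of I11 is represented by a function on R of which only the values
   on I11 matter.  [D_in] and [continue_in] restrict the limits to points of I11,
   so they are one-sided at the endpoints -1 and 1.  The derivative is a field;
   its values on I11 are determined by [fn] and those outside I11 are irrelevant. *)
Record C1_map := {
  fn :> R -> R;
  deriv : R -> R;
  fn_maps : forall t, I11 t -> I11 (fn t);
  fn_deriv : forall t, I11 t -> D_in fn deriv I11 t;
  deriv_cont : forall t, I11 t -> continue_in deriv I11 t
}.

Record P_configuration := {
  delta1 : C1_map;
  delta2 : C1_map;
  delta_sum : forall t, I11 t -> delta1 t + delta2 t = t;
  delta1_mono : forall t, I11 t -> 0 <= deriv delta1 t;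
  delta2_mono : forall t, I11 t -> 0 <= deriv delta2 t;
  delta2_left : delta2 (-1) = -1;
  delta2_right : delta2 1 = 0;
  delta1_left : delta1 (-1) = 0;
  delta1_right : delta1 1 = 1
}.

Definition Lambda1 (P : P_configuration) (t : R) : Prop :=
  I11 t /\ deriv (delta1 P) t = 0.

Definition Lambda2 (P : P_configuration) (t : R) : Prop :=
  I11 t /\ deriv (delta2 P) t = 0.

Definition homeomorphism_I (h : R -> R) : Prop :=
  exists k : R -> R,
    (forall t, I11 t -> I11 (h t) /\ k (h t) = t /\ continue_in h I11 t) /\
    (forall s, I11 s -> I11 (k s) /\ h (k s) = s /\ continue_in k I11 s).

Definition image (h : R -> R) (A : R -> Prop) (s : R) : Prop :=
  exists t, A t /\ h t = s.

Definition isomorphic (P Q : P_configuration) : Prop :=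
  exists h : R -> R,
    homeomorphism_I h /\
    (forall s, image h (Lambda1 P) s <-> Lambda1 Q s) /\
    (forall s, image h (Lambda2 P) s <-> Lambda2 Q s) /\
    (forall t, I11 t -> h (delta1 P t) = delta1 Q (h t)) /\
    (forall t, I11 t -> h (delta2 P t) = delta2 Q (h t)).

(* Main.v *)
Require Import Defs.
From Stdlib Require Import Reals.
From Stdlib Require Import Lra Lia.
Open Scope R_scope.

(** Let [y_k] be the orbit of 0 under [delta1].  An isomorphism [h] fixes 1, the
    unique fixed point of [delta1], hence also fixes [delta2 1 = 0]; being
    continuous and injective it is therefore increasing on [0,1].  It carries
    the orbit of one configuration to that of the other, index by index, and the
    single point [a] of [Lambda1] to its counterpart.  So the set of [k] with
    [y_k < a] is an isomorphism invariant
    ([isomorphism_preserves_orbit_order]), and it suffices to find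
    configurations for which it differs.

    Take [delta1'] proportional to [x^2 / (x^2 + w^2)] with [x = t - a].  It
    vanishes exactly at [a], and up to a narrow dip around [a] it is nearly the
    constant 1/2.  The primitive is [x - w * atan (x / w)], which differs from
    [x] by at most a multiple of [w], so the distance [v_k = 1 - y_k] obeys the
    explicit bounds [(1/2)^k - 4 w <= v_k <= (2/3)^k] ([dip_orbit_bounds]).
    With [1 - a = (1/2)^(N+1)] and [w] of order [(1/2)^N], the orbit is still
    below [a] for [k <= N] and is above [a] once [k >= 2 (N + 1)], because
    [(2/3)^2 < 1/2].  Two parameters [M], [N] with [2 (M + 1) <= N] thus give
    non-isomorphic configurations, and the powers of 4 are that sparse. *)

(** * Calculus relative to the interval *)

Lemma limit_restrict (f : R -> R) (D E : R -> Prop) (l x : R) :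
  (forall t, E t -> D t) -> limit1_in f D l x -> limit1_in f E l x.
Proof.
  intros HED H eps Heps.
  destruct (H eps Heps) as [alp [Halp HD]].
  exists alp; split; [exact Halp|].
  intros t [Ht Hd]; apply HD; split; auto.
Qed.

Lemma derivable_pt_lim_D_in_I (f d : R -> R) (t : R) :
  derivable_pt_lim f t (d t) -> D_in f d I11 t.
Proof.
  intros H; apply derivable_pt_lim_D_in in H.
  refine (limit_restrict _ _ _ _ _ _ H).
  intros s [_ Hs]; split; [exact I | exact Hs].
Qed.

Lemma continuity_pt_continue_in_I (f : R -> R) (t : R) :
  continuity_pt f t -> continue_in f I11 t.
Proof.
  intros H; refine (limit_restrict _ _ _ _ _ _ H).
  intros s [_ Hs]; split; [exact I | exact Hs].
Qed.

(** Extending [h] by its boundary values turns continuity relative to the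
    interval into continuity on the whole line, which the intermediate value
    theorem asks for. *)
Definition clamp (t : R) : R := Rmax (-1) (Rmin 1 t).

Lemma clamp_I (t : R) : I11 (clamp t).
Proof.
  unfold I11, clamp, Rmax, Rmin.
  destruct (Rle_dec 1 t); destruct (Rle_dec (-1) _); lra.
Qed.

Lemma clamp_id (t : R) : I11 t -> clamp t = t.
Proof.
  unfold I11, clamp, Rmax, Rmin; intros Ht.
  destruct (Rle_dec 1 t); destruct (Rle_dec (-1) _); lra.
Qed.

Lemma clamp_contracts (s t : R) : Rabs (clamp s - clamp t) <= Rabs (s - t).
Proof.
  unfold clamp, Rmax, Rmin, Rabs.
  destruct (Rle_dec 1 s); destruct (Rle_dec 1 t);
    repeat destruct (Rle_dec (-1) _); repeat destruct (Rcase_abs _); lra.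
Qed.

Lemma continuity_clamp (h : R -> R) :
  (forall t, I11 t -> continue_in h I11 t) -> continuity (fun t => h (clamp t)).
Proof.
  intros Hh t eps Heps.
  destruct (Hh (clamp t) (clamp_I t) eps Heps) as [alp [Halp Hlim]].
  exists alp; split; [exact Halp|].
  intros s [_ Hs]; cbn in *; unfold R_dist in *.
  destruct (Req_dec (clamp t) (clamp s)) as [E | E].
  - rewrite E, Rminus_diag, Rabs_R0; exact Heps.
  - apply Hlim; split.
    + split; [apply clamp_I | exact E].
    + eapply Rle_lt_trans; [apply clamp_contracts | exact Hs].
Qed.

Lemma IVT_in_I (h : R -> R) (x y v : R) :
  (forall t, I11 t -> continue_in h I11 t) ->
  I11 x -> I11 y -> x <= y -> h x <= v <= h y ->
  exists z, x <= z <= y /\ h z = v.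
Proof.
  intros Hh Hx Hy Hxy Hv.
  destruct (IVT_cor (fun t => h (clamp t) - v) x y) as [z [Hz Ez]].
  - apply continuity_minus; [exact (continuity_clamp h Hh)|].
    apply continuity_const; intros ? ?; reflexivity.
  - exact Hxy.
  - cbn; rewrite (clamp_id x Hx), (clamp_id y Hy); nra.
  - exists z; split; [exact Hz|].
    cbn in Ez; rewrite clamp_id in Ez; [lra | unfold I11 in *; lra].
Qed.

(** If [h y < h x] with [x < y], then a value is taken twice: [h y] somewhere
    between 0 and [x] when [h y >= 0], and otherwise [h 0 = 0] between [y] and 1. *)
Lemma injective_continuous_increasing (h : R -> R) :
  (forall t, I11 t -> continue_in h I11 t) ->
  (forall s t, I11 s -> I11 t -> h s = h t -> s = t) ->
  h 0 = 0 -> h 1 = 1 ->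
  forall x y, 0 <= x -> x < y -> y <= 1 -> h x < h y.
Proof.
  intros Hc Hinj H0 H1 x y Hx Hxy Hy.
  assert (Ix : I11 x) by (unfold I11; lra).
  assert (Iy : I11 y) by (unfold I11; lra).
  assert (I0 : I11 0) by (unfold I11; lra).
  assert (I1 : I11 1) by (unfold I11; lra).
  apply Rnot_le_lt; intros Hle.
  destruct (Rle_dec 0 (h y)) as [Hp | Hn].
  - destruct (IVT_in_I h 0 x (h y) Hc I0 Ix Hx ltac:(lra)) as [z [Hz Ez]].
    apply Hinj in Ez; [lra | unfold I11; lra | exact Iy].
  - destruct (IVT_in_I h y 1 0 Hc Iy I1 Hy ltac:(lra)) as [z [Hz Ez]].
    rewrite <- H0 in Ez.
    apply Hinj in Ez; [lra | unfold I11; lra | exact I0].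
Qed.

(** * An isomorphism invariant *)

Definition orbit (P : P_configuration) (k : nat) : R := Nat.iter k (delta1 P) 0.

Lemma orbit_I (P : P_configuration) (k : nat) : I11 (orbit P k).
Proof.
  induction k as [|k IH]; [unfold orbit, I11; cbn; lra|].
  exact (fn_maps (delta1 P) _ IH).
Qed.

(** The invariant: an isomorphism fixes 0 and 1, hence preserves order on [0,1],
    and it maps the orbit of 0 and the point of [Lambda1] to their
    counterparts.  The hypothesis [0 <= delta1 P t] keeps the orbit inside
    [0,1], where [h] is known to increase. *)
Lemma isomorphism_preserves_orbit_order (P Q : P_configuration) (a b : R) :
  isomorphic P Q ->
  (forall t, I11 t -> delta1 Q t = t -> t = 1) ->
  (forall t, I11 t -> 0 <= delta1 P t) ->
  0 <= a ->
  (forall t, Lambda1 P t <-> t = a) ->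
  (forall t, Lambda1 Q t <-> t = b) ->
  forall k, (orbit P k < a -> orbit Q k < b) /\ (a < orbit P k -> b < orbit Q k).
Proof.
  intros [h [[g [Hh _]] [HL1 [_ [H1 H2]]]]] Hfix Hpos Ha HP HQ k.
  assert (I1 : I11 1) by (unfold I11; lra).
  assert (h1 : h 1 = 1).
  { apply Hfix; [apply Hh; exact I1|].
    rewrite <- (H1 1 I1), delta1_right; reflexivity. }
  assert (h0 : h 0 = 0).
  { assert (E := H2 1 I1); rewrite h1, !delta2_right in E; exact E. }
  assert (hinj : forall s t, I11 s -> I11 t -> h s = h t -> s = t).
  { intros s t Hs Ht E.
    destruct (Hh s Hs) as [_ [<- _]]; destruct (Hh t Ht) as [_ [<- _]].
    rewrite E; reflexivity. }
  assert (hincr := injective_continuous_increasing h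
                     (fun t Ht => proj2 (proj2 (Hh t Ht))) hinj h0 h1).
  assert (hab : h a = b).
  { apply HQ, HL1; exists a; split; [apply HP; reflexivity | reflexivity]. }
  assert (horb : h (orbit P k) = orbit Q k).
  { induction k as [|k IH]; [exact h0|].
    change (h (delta1 P (orbit P k)) = delta1 Q (orbit Q k)).
    rewrite H1 by apply orbit_I; rewrite IH; reflexivity. }
  assert (orb0 : 0 <= orbit P k).
  { destruct k as [|k]; [cbn; lra | exact (Hpos _ (orbit_I P k))]. }
  assert (Hor := orbit_I P k).
  assert (Ia : I11 a) by (apply (HP a); reflexivity).
  unfold I11 in *.
  rewrite <- hab, <- horb; split; intros; apply hincr; lra.
Qed.

(** * A derivative with one narrow dip *)

Definition dip (w x : R) : R := x ^ 2 / (x ^ 2 + w ^ 2).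

Definition dip_primitive (w x : R) : R := x - w * atan (x / w).

Lemma dip_bounds (w x : R) : 0 < w -> 0 <= dip w x <= 1.
Proof.
  intros Hw; unfold dip; split.
  - apply Rmult_le_pos; [nra|]. left; apply Rinv_0_lt_compat; nra.
  - apply Rmult_le_reg_r with (x ^ 2 + w ^ 2); [nra|].
    field_simplify; nra.
Qed.

Lemma dip_eq_0 (w x : R) : 0 < w -> dip w x = 0 <-> x = 0.
Proof.
  intros Hw; unfold dip; split.
  - intros H. apply Rmult_integral in H as [H | H]; [nra|].
    exfalso; revert H; apply Rinv_neq_0_compat; nra.
  - intros ->; field; lra.
Qed.

Lemma continuity_dip (w : R) : 0 < w -> continuity (dip w).
Proof.
  intros Hw x; unfold dip; reg; nra.
Qed.

Lemma derivable_dip_primitive (w x : R) :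
  0 < w -> derivable_pt_lim (dip_primitive w) x (dip w x).
Proof.
  intros Hw.
  replace (dip w x)
    with (1 - w * (/ (1 + (x / w)²) * / w)) by (unfold dip, Rsqr; field; nra).
  apply derivable_pt_lim_minus; [apply derivable_pt_lim_id|].
  apply derivable_pt_lim_scal.
  apply (derivable_pt_lim_comp (fun x => x / w) atan).
  - replace (/ w) with (1 * / w + x * 0) by ring.
    apply (derivable_pt_lim_mult id (fun _ => / w)).
    + apply derivable_pt_lim_id.
    + apply derivable_pt_lim_const.
  - replace (/ (1 + (x / w)²)) with (/ (1 + (x / w) ^ 2)) by (f_equal; unfold Rsqr; ring).
    apply derivable_pt_lim_atan.
Qed.

(** The derivative of [dip_primitive] lies in [0,1]; hence it is both
    nondecreasing and 1-Lipschitz. *)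
Lemma dip_primitive_increment (w r s : R) :
  0 < w -> r <= s ->
  0 <= dip_primitive w s - dip_primitive w r <= s - r.
Proof.
  intros Hw [Hrs | <-]; [|lra].
  destruct (MVT_cor2 (dip_primitive w) (dip w) r s Hrs) as [x [E _]].
  - intros x _; apply derivable_dip_primitive; exact Hw.
  - rewrite E; assert (H := dip_bounds w x Hw); nra.
Qed.

(** The two arctangents differ by less than [PI <= 4], so the dip costs at most
    [4 * w] of increment, wherever it is located. *)
Lemma dip_primitive_increment_lower (w r s : R) :
  0 < w -> s - r - 4 * w <= dip_primitive w s - dip_primitive w r.
Proof.
  intros Hw; unfold dip_primitive.
  assert (Hr := atan_bound (r / w)); assert (Hs := atan_bound (s / w)).
  assert (HPI := PI_4); nra.
Qed.

(** * Configurations with one dip *)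

(** The total increment over the interval: dividing by it makes [delta1] rise by
    exactly 1 from -1 to 1. *)
Definition total (a w : R) : R := dip_primitive w (1 - a) - dip_primitive w (-1 - a).

Lemma total_bounds (a w : R) : 0 < w -> 2 - 4 * w <= total a w <= 2.
Proof.
  intros Hw; unfold total.
  assert (H1 := dip_primitive_increment w (-1 - a) (1 - a) Hw ltac:(lra)).
  assert (H2 := dip_primitive_increment_lower w (-1 - a) (1 - a) Hw).
  lra.
Qed.

(** The rescaled primitive is normalised at the right endpoint, since the
    estimates concern the distance of [dip_delta1] to its fixed point 1. *)
Definition dip_delta1 (a w t : R) : R :=
  1 - (dip_primitive w (1 - a) - dip_primitive w (t - a)) / total a w.

Definition dip_delta2 (a w t : R) : R := t - dip_delta1 a w t.

Lemma inv_total_bounds (a w : R) : 0 < w <= 1 / 8 -> 1 / 2 <= / total a w <= 2 / 3.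
Proof.
  intros Hw; assert (H := total_bounds a w ltac:(lra)).
  replace (1 / 2) with (/ 2) by lra; replace (2 / 3) with (/ (3 / 2)) by lra.
  split; apply Rinv_le_contravar; lra.
Qed.

(** The slope of [dip_delta1] is at most 2/3, so 1 is its only fixed point and
    attracts every orbit geometrically. *)
Lemma dip_delta1_contracts (a w t : R) :
  0 < w <= 1 / 8 -> I11 t -> 0 <= 1 - dip_delta1 a w t <= 2 / 3 * (1 - t).
Proof.
  intros Hw Ht; unfold dip_delta1, Rdiv, I11 in *.
  assert (H := inv_total_bounds a w Hw).
  assert (H' := dip_primitive_increment w (t - a) (1 - a) ltac:(lra) ltac:(lra)).
  nra.
Qed.

(** The slope is at least 1/2 apart from the loss caused by the dip, so orbits
    cannot approach 1 much faster than [(1/2)^k]. *)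
Lemma dip_delta1_halves (a w t : R) :
  0 < w <= 1 / 8 -> I11 t -> (1 - t - 4 * w) / 2 <= 1 - dip_delta1 a w t.
Proof.
  intros Hw Ht; unfold dip_delta1, Rdiv, I11 in *.
  assert (H := inv_total_bounds a w Hw).
  assert (H' := dip_primitive_increment w (t - a) (1 - a) ltac:(lra) ltac:(lra)).
  assert (H'' := dip_primitive_increment_lower w (t - a) (1 - a) ltac:(lra)).
  nra.
Qed.

Lemma dip_delta1_left (a w : R) : 0 < w <= 1 / 8 -> dip_delta1 a w (-1) = 0.
Proof.
  intros Hw; assert (H := total_bounds a w ltac:(lra)).
  unfold dip_delta1; fold (total a w); field; lra.
Qed.

Lemma dip_delta1_right (a w : R) : dip_delta1 a w 1 = 1.
Proof.
  unfold dip_delta1, Rdiv; ring.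
Qed.

Lemma dip_delta1_between (a w t : R) :
  0 < w <= 1 / 8 -> I11 t -> 0 <= dip_delta1 a w t <= t + 1.
Proof.
  intros Hw Ht.
  assert (H0 := dip_delta1_left a w Hw).
  assert (H := inv_total_bounds a w Hw); unfold dip_delta1, Rdiv, I11 in *.
  assert (H' := dip_primitive_increment w (-1 - a) (t - a) ltac:(lra) ltac:(lra)).
  nra.
Qed.

Lemma dip_delta1_maps (a w t : R) : 0 < w <= 1 / 8 -> I11 t -> I11 (dip_delta1 a w t).
Proof.
  intros Hw Ht.
  assert (H := dip_delta1_contracts a w t Hw Ht).
  assert (H' := dip_delta1_between a w t Hw Ht).
  unfold I11; lra.
Qed.

Lemma dip_delta2_maps (a w t : R) : 0 < w <= 1 / 8 -> I11 t -> I11 (dip_delta2 a w t).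
Proof.
  intros Hw Ht.
  assert (H := dip_delta1_contracts a w t Hw Ht).
  assert (H' := dip_delta1_between a w t Hw Ht).
  unfold dip_delta2, I11 in *; lra.
Qed.

Lemma dip_delta1_deriv (a w t : R) :
  0 < w -> derivable_pt_lim (dip_delta1 a w) t (dip w (t - a) / total a w).
Proof.
  intros Hw; unfold dip_delta1.
  set (A := dip_primitive w (1 - a)).
  (* The derivative as the product rule gives it, for a constant factor. *)
  replace (dip w (t - a) / total a w)
    with (0 - ((0 - dip w (t - a) * (1 - 0)) * / total a w
               + (A - dip_primitive w (t - a)) * 0)) by (unfold Rdiv; ring).
  apply derivable_pt_lim_minus; [apply derivable_pt_lim_const|].
  apply (derivable_pt_lim_mult (fun t => A - dip_primitive w (t - a)) (fun _ => / total a w));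
    [|apply derivable_pt_lim_const].
  apply derivable_pt_lim_minus; [apply derivable_pt_lim_const|].
  apply (derivable_pt_lim_comp (fun t => t - a) (dip_primitive w)).
  - apply derivable_pt_lim_minus; [apply derivable_pt_lim_id | apply derivable_pt_lim_const].
  - apply derivable_dip_primitive; exact Hw.
Qed.

Lemma dip_delta2_deriv (a w t : R) :
  0 < w -> derivable_pt_lim (dip_delta2 a w) t (1 - dip w (t - a) / total a w).
Proof.
  intros Hw; apply derivable_pt_lim_minus;
    [apply derivable_pt_lim_id | apply dip_delta1_deriv; exact Hw].
Qed.

(** Strictness of the upper bound is what makes [Lambda2] empty: it holds because
    the total increment exceeds 1. *)
Lemma dip_delta1_deriv_bounds (a w t : R) :
  0 < w <= 1 / 8 -> 0 <= dip w (t - a) / total a w < 1.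
Proof.
  intros Hw; unfold Rdiv.
  assert (H := inv_total_bounds a w Hw).
  assert (H' := dip_bounds w (t - a) ltac:(lra)); nra.
Qed.

Lemma continuity_dip_delta1_deriv (a w : R) :
  0 < w -> continuity (fun t => dip w (t - a) / total a w).
Proof.
  intros Hw; unfold Rdiv.
  apply (continuity_mult (fun t => dip w (t - a)) (fun _ => / total a w)).
  - apply (continuity_comp (fun t => t - a) (dip w)); [reg | apply continuity_dip; exact Hw].
  - apply continuity_const; intros ? ?; reflexivity.
Qed.

Definition dip_map1 (a w : R) (Hw : 0 < w <= 1 / 8) : C1_map := {|
  fn := dip_delta1 a w;
  deriv := fun t => dip w (t - a) / total a w;
  fn_maps := fun t Ht => dip_delta1_maps a w t Hw Ht;
  fn_deriv := fun t _ =>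
    derivable_pt_lim_D_in_I (dip_delta1 a w) (fun t => dip w (t - a) / total a w) t
      (dip_delta1_deriv a w t (proj1 Hw));
  deriv_cont := fun t _ =>
    continuity_pt_continue_in_I _ t (continuity_dip_delta1_deriv a w (proj1 Hw) t)
|}.

Lemma continuity_dip_delta2_deriv (a w : R) :
  0 < w -> continuity (fun t => 1 - dip w (t - a) / total a w).
Proof.
  intros Hw; apply (continuity_minus (fun _ => 1)).
  - apply continuity_const; intros ? ?; reflexivity.
  - apply continuity_dip_delta1_deriv; exact Hw.
Qed.

Definition dip_map2 (a w : R) (Hw : 0 < w <= 1 / 8) : C1_map := {|
  fn := dip_delta2 a w;
  deriv := fun t => 1 - dip w (t - a) / total a w;
  fn_maps := fun t Ht => dip_delta2_maps a w t Hw Ht;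
  fn_deriv := fun t _ =>
    derivable_pt_lim_D_in_I (dip_delta2 a w) (fun t => 1 - dip w (t - a) / total a w) t
      (dip_delta2_deriv a w t (proj1 Hw));
  deriv_cont := fun t _ =>
    continuity_pt_continue_in_I _ t (continuity_dip_delta2_deriv a w (proj1 Hw) t)
|}.

Definition dip_configuration (a w : R) (Hw : 0 < w <= 1 / 8) : P_configuration.
Proof.
  refine {| delta1 := dip_map1 a w Hw; delta2 := dip_map2 a w Hw |};
    cbn; unfold dip_delta2; intros;
    rewrite ?(dip_delta1_left a w Hw), ?dip_delta1_right; try lra;
    assert (H' := dip_delta1_deriv_bounds a w t Hw); lra.
Defined.

Lemma dip_configuration_Lambda1 (a w : R) (Hw : 0 < w <= 1 / 8) :
  I11 a -> forall t, Lambda1 (dip_configuration a w Hw) t <-> t = a.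
Proof.
  intros Ha t; unfold Lambda1; cbn.
  assert (H := inv_total_bounds a w Hw).
  split.
  - intros [_ E]; apply Rmult_integral in E as [E | E]; [|lra].
    apply dip_eq_0 in E; lra.
  - intros ->; split; [exact Ha|].
    replace (dip w (a - a)) with 0; [unfold Rdiv; ring|].
    symmetry; apply dip_eq_0; lra.
Qed.

Lemma dip_configuration_Lambda2 (a w : R) (Hw : 0 < w <= 1 / 8) (t : R) :
  ~ Lambda2 (dip_configuration a w Hw) t.
Proof.
  intros [_ E]; cbn in E.
  assert (H := dip_delta1_deriv_bounds a w t Hw); lra.
Qed.

(** The error [4 * w] does not accumulate along the orbit: it is halved at each
    step and the dip adds back [2 * w], so [4 * w] is its fixed value. *)
Lemma dip_orbit_bounds (a w : R) (Hw : 0 < w <= 1 / 8) (k : nat) :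
  (1 / 2) ^ k - 4 * w <= 1 - orbit (dip_configuration a w Hw) k <= (2 / 3) ^ k.
Proof.
  induction k as [|k IH]; [cbn; lra|].
  assert (Ik := orbit_I (dip_configuration a w Hw) k).
  change (orbit (dip_configuration a w Hw) (S k))
    with (dip_delta1 a w (orbit (dip_configuration a w Hw) k)).
  assert (H := dip_delta1_contracts a w _ Hw Ik).
  assert (H' := dip_delta1_halves a w _ Hw Ik).
  cbn [pow]; lra.
Qed.

(** * Dips approaching 1 *)

Lemma pow_antitone (q : R) (j k : nat) : 0 <= q <= 1 -> (j <= k)%nat -> q ^ k <= q ^ j.
Proof.
  intros Hq Hjk; replace k with (j + (k - j))%nat by lia.
  rewrite pow_add.
  assert (H1 : 0 <= q ^ j) by (apply pow_le; lra).
  assert (H2 : q ^ (k - j) <= 1) by (rewrite <- (pow1 (k - j)); apply pow_incr; lra).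
  nra.
Qed.

(** The dip sits between the bounds available for the orbit at times [N] and
    [2 * (N + 1)]: with this width the lower bound at time [N] is
    [3/4 * (1/2)^N], which still exceeds [1 - position N = 1/2 * (1/2)^N]. *)
Definition position (N : nat) : R := 1 - (1 / 2) ^ S N.

Definition width (N : nat) : R := (1 / 2) ^ N / 16.

Lemma half_pow_bounds (N : nat) : 0 < (1 / 2) ^ N <= 1.
Proof.
  split; [apply pow_lt; lra|].
  exact (pow_antitone (1 / 2) 0 N ltac:(lra) (Nat.le_0_l N)).
Qed.

Lemma width_bounds (N : nat) : 0 < width N <= 1 / 8.
Proof.
  assert (H := half_pow_bounds N); unfold width; lra.
Qed.

Definition configuration (N : nat) : P_configuration :=
  dip_configuration (position N) (width N) (width_bounds N).

Lemma position_bounds (N : nat) : 0 <= position N <= 1.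
Proof.
  assert (H := half_pow_bounds N); unfold position; cbn [pow]; lra.
Qed.

Lemma configuration_Lambda1 (N : nat) (t : R) :
  Lambda1 (configuration N) t <-> t = position N.
Proof.
  apply dip_configuration_Lambda1.
  assert (H := position_bounds N); unfold I11; lra.
Qed.

Lemma orbit_before (N k : nat) :
  (k <= N)%nat -> orbit (configuration N) k < position N.
Proof.
  intros Hk.
  assert (H := dip_orbit_bounds (position N) (width N) (width_bounds N) k).
  assert (H1 := pow_antitone (1 / 2) k N ltac:(lra) Hk).
  assert (H2 := half_pow_bounds N).
  fold (configuration N) in H; unfold width, position in *; cbn [pow]; lra.
Qed.

(** Two steps shrink the distance to 1 by a factor [(2/3)^2 = 4/9 < 1/2]. *)
Lemma orbit_after (N k : nat) :
  (2 * S N <= k)%nat -> position N < orbit (configuration N) k.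
Proof.
  intros Hk.
  assert (H := dip_orbit_bounds (position N) (width N) (width_bounds N) k).
  assert (H1 := pow_antitone (2 / 3) _ k ltac:(lra) Hk).
  rewrite pow_mult in H1.
  assert (H2 : ((2 / 3) ^ 2) ^ S N < (1 / 2) ^ S N).
    (* Strictness comes from one of the [S N] factors, the rest compare weakly. *)
  { assert (G : forall n, 0 < ((2 / 3) ^ 2) ^ n <= (1 / 2) ^ n).
    { intros n; split; [apply pow_lt; lra | apply pow_incr; lra]. }
    specialize (G N); cbn [pow] in *; lra. }
  fold (configuration N) in H; unfold position in *; lra.
Qed.

(** The time [2 * (min M N + 1)] separates them: one orbit has passed its dip by
    then and the other has not. *)
Lemma configuration_not_isomorphic (M N : nat) :
  (2 * S M <= N \/ 2 * S N <= M)%nat ->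
  ~ isomorphic (configuration M) (configuration N).
Proof.
  intros HMN Hiso.
  assert (Hord : forall k,
    (orbit (configuration M) k < position M -> orbit (configuration N) k < position N) /\
    (position M < orbit (configuration M) k -> position N < orbit (configuration N) k)).
  { apply isomorphism_preserves_orbit_order; [exact Hiso | | | | |].
    - intros t Ht E.
      assert (H := dip_delta1_contracts (position N) (width N) t (width_bounds N) Ht).
      cbn in E; lra.
    - intros t Ht; apply dip_delta1_between; [apply width_bounds | exact Ht].
    - apply position_bounds.
    - apply configuration_Lambda1.
    - apply configuration_Lambda1. }
  destruct HMN as [H | H].
  - assert (H1 := orbit_before N _ H).
    assert (H2 := proj2 (Hord _) (orbit_after M _ (le_n _))); lra.
  - assert (H1 := proj1 (Hord _) (orbit_before M _ H)).
    assert (H2 := orbit_after N _ (le_n _)); lra.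
Qed.

Lemma four_pow_sparse (m n : nat) : (m < n)%nat -> (2 * S (4 ^ m) <= 4 ^ n)%nat.
Proof.
  intros H.
  assert (H1 := Nat.pow_le_mono_r 4 (S m) n ltac:(lia) H).
  assert (H2 : (4 ^ m <> 0)%nat) by (apply Nat.pow_nonzero; lia).
  rewrite Nat.pow_succ_r' in H1; lia.
Qed.

Theorem proposition5p1 :
  exists P : nat -> P_configuration,
    (forall n : nat,
       (forall t : R, ~ Lambda2 (P n) t) /\
       (exists a : R, forall t : R, Lambda1 (P n) t <-> t = a)) /\
    (forall m n : nat, m <> n -> ~ isomorphic (P m) (P n)).
Proof.
  exists (fun n => configuration (4 ^ n)); split.
  - intros n; split.
    + intros t; apply dip_configuration_Lambda2.
    + exists (position (4 ^ n)); apply configuration_Lambda1.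
  - intros m n Hmn; apply configuration_not_isomorphic.
    destruct (Nat.lt_gt_cases m n) as [[H | H] _]; [exact Hmn | |].
    + left; apply four_pow_sparse; exact H.
    + right; apply four_pow_sparse; exact H.
Qed.
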